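(* Let $n\in\mathbb{N}$ and let $A(p)$ be an $\mathcal{L}'$-formula modalized in $p$. Then there is an $\mathcal{L}$-formula $B$ containing only predicate symbols and free variables occurring in $A(p)$ such that $$\mathbf{QK}\vdash \Box^{n+1}\bot\to(B\leftrightarrow A(B)).$$ Moreover, such a formula $B$ is effectively calculable from $A(p)$.
   Context: Language $\mathcal{L}$: countably many individual variables, Boolean constants $\top,\bot$, connectives $\neg,\to$, quantifier $\forall$, modal operator $\Box$, countably many predicate symbols of each arity. Formulas: $\top$, $\bot$, $P(u_1,\ldots,u_n)$, closed under $\neg$, $\to$, $\forall u$, $\Box$. $\Box^{k}A$ denotes $A$ prefixed by $k$ boxes. $\mathcal{L}'$ is $\mathcal{L}$ together with one fixed propositional variable $p$. For an $\mathcal{L}'$-formula $A(p)$ and $\mathcal{L}$-formula $B$, $A(B)$ is the result of replacing every occurrence of $p$ by $B$. $A(p)$ is modalized in $p$ if every occurrence of $p$ lies within the scope of a $\Box$. $\mathbf{QK}$ is the predicate modal logic axiomatized by all instances (in the modal language) of the axioms of classical first-order predicate logic and $\Box(A\to B)\to(\Box A\to\Box B)$, with the rules of predicate logic (modus ponens and generalization) and necessitation $A/\Box A$. *)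

(* Defs.v *)
From mathcomp Require Import all_boot.
From Stdlib Require Import Relation_Operators.

Set Implicit Arguments.
Unset Strict Implicit.
Unset Printing Implicit Defensive.

(** * Formulas *)

(* Individual variables are natural numbers.  A predicate symbol is a pair
   (i, k), the i-th symbol of arity k (k = 0 allowed); [Atom i us] is the
   predicate symbol (i, size us) applied to us.  The parameter V is the type of
   the propositional variables added to the language: none for L, the single
   variable p for L'. *)
Inductive form (V : Type) : Type :=
| Top
| Bot
| PVar of V
| Atom of nat & seq nat
| Neg of form V
| Imp of form V & form V
| All of nat & form V
| Box of form V.

Arguments Top {V}.
Arguments Bot {V}.
Arguments Atom {V} i us.

Notation L := (form void).
Notation L' := (form unit).

Definition And V (A B : form V) : form V := Neg (Imp A (Neg B)).
Definition Iff V (A B : form V) : form V := And (Imp A B) (Imp B A).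
Definition Boxn V (k : nat) (A : form V) : form V := iter k (@Box V) A.

Fixpoint preds V (A : form V) : seq (nat * nat) :=
  match A with
  | Top | Bot | PVar _ => [::]
  | Atom i us => [:: (i, size us)]
  | Neg B | All _ B | Box B => preds B
  | Imp B C => preds B ++ preds C
  end.

Fixpoint fv V (A : form V) : seq nat :=
  match A with
  | Top | Bot | PVar _ => [::]
  | Atom _ us => us
  | Neg B | Box B => fv B
  | Imp B C => fv B ++ fv C
  | All u B => [seq x <- fv B | x != u]
  end.

Fixpoint modalized (A : L') : bool :=
  match A with
  | Top | Bot | Atom _ _ | Box _ => true
  | PVar _ => false
  | Neg B | All _ B => modalized B
  | Imp B C => modalized B && modalized C
  end.

(* A(B).  The replacement is literal: free variables of B may become bound by
   quantifiers of A. *)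
Fixpoint fill (A : L') (B : L) : L :=
  match A with
  | Top => Top
  | Bot => Bot
  | PVar _ => B
  | Atom i us => Atom i us
  | Neg C => Neg (fill C B)
  | Imp C D => Imp (fill C B) (fill D B)
  | All u C => All u (fill C B)
  | Box C => Box (fill C B)
  end.

(** * The logic QK *)

(* [vsubst u v A] replaces the free occurrences of u in A by v; it is only
   meaningful when [free_for u v A] holds. *)
Fixpoint vsubst V (u v : nat) (A : form V) : form V :=
  match A with
  | Top => Top
  | Bot => Bot
  | PVar q => PVar q
  | Atom i us => Atom i [seq if x == u then v else x | x <- us]
  | Neg B => Neg (vsubst u v B)
  | Imp B C => Imp (vsubst u v B) (vsubst u v C)
  | All w B => if w == u then All w B else All w (vsubst u v B)
  | Box B => Box (vsubst u v B)
  end.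

(* No free occurrence of u in A lies in the scope of a quantifier on v. *)
Fixpoint free_for V (u v : nat) (A : form V) : bool :=
  match A with
  | Top | Bot | PVar _ | Atom _ _ => true
  | Neg B | Box B => free_for u v B
  | Imp B C => free_for u v B && free_for u v C
  | All w B => (u \notin fv (All w B)) || ((w != v) && free_for u v B)
  end.

Inductive QK V : form V -> Prop :=
| QK_K A B : QK (Imp A (Imp B A))
| QK_S A B C :
    QK (Imp (Imp A (Imp B C)) (Imp (Imp A B) (Imp A C)))
| QK_contra A B : QK (Imp (Imp (Neg A) (Neg B)) (Imp B A))
| QK_top : QK Top
| QK_bot A : QK (Imp Bot A)
| QK_inst u v A : free_for u v A -> QK (Imp (All u A) (vsubst u v A))
| QK_distr u A B : u \notin fv A ->
    QK (Imp (All u (Imp A B)) (Imp A (All u B)))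
| QK_norm A B : QK (Imp (Box (Imp A B)) (Imp (Box A) (Box B)))
| QK_mp A B : QK (Imp A B) -> QK A -> QK B
| QK_gen u A : QK A -> QK (All u A)
| QK_nec A : QK A -> QK (Box A).

(** * Effective calculability *)

(* Weak call-by-value lambda-calculus on de Bruijn terms, a Turing-complete
   model of computation.  Reduction is only meant for closed terms, so that
   substitution need not lift the substituted term. *)
Inductive term : Type :=
| Var of nat
| App of term & term
| Lam of term.

Fixpoint closed_at (k : nat) (s : term) : bool :=
  match s with
  | Var i => i < k
  | App s1 s2 => closed_at k s1 && closed_at k s2
  | Lam s1 => closed_at k.+1 s1
  end.

Fixpoint tsubst (s : term) (k : nat) (t : term) : term :=
  match s with
  | Var i => if i == k then t else Var i
  | App s1 s2 => App (tsubst s1 k t) (tsubst s2 k t)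
  | Lam s1 => Lam (tsubst s1 k.+1 t)
  end.

Inductive step : term -> term -> Prop :=
| step_beta s t : step (App (Lam s) (Lam t)) (tsubst s 0 (Lam t))
| step_appl s s' t : step s s' -> step (App s t) (App s' t)
| step_appr s t t' : step t t' -> step (App s t) (App s t').

Definition reduces : term -> term -> Prop := clos_refl_trans term step.

(* Scott encoding of the j-th (from 0) of c constructors, applied to the
   encoded arguments ts: \x_0 ... x_(c-1). x_j ts. *)
Definition scott (c j : nat) (ts : seq term) : term :=
  iter c Lam (foldl App (Var (c - j.+1)) ts).

Fixpoint enc_nat (i : nat) : term :=
  if i is i'.+1 then scott 2 1 [:: enc_nat i'] else scott 2 0 [::].

Fixpoint enc_seq (us : seq nat) : term :=
  if us is u :: us' then scott 2 1 [:: enc_nat u; enc_seq us']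
  else scott 2 0 [::].

(* For V = void and V = unit, PVar needs no argument in the encoding. *)
Fixpoint enc V (A : form V) : term :=
  match A with
  | Top => scott 8 0 [::]
  | Bot => scott 8 1 [::]
  | PVar _ => scott 8 2 [::]
  | Atom i us => scott 8 3 [:: enc_nat i; enc_seq us]
  | Neg B => scott 8 4 [:: enc B]
  | Imp B C => scott 8 5 [:: enc B; enc C]
  | All u B => scott 8 6 [:: enc_nat u; enc B]
  | Box B => scott 8 7 [:: enc B]
  end.

Definition effectively_calculable (F : L' -> L) : Prop :=
  exists2 t : term, closed_at 0 t & forall A, reduces (App t (enc A)) (enc (F A)).

(** * Fixed points *)

Definition fixed_point_mod (n : nat) (A : L') (B : L) : Prop :=
  [/\ {subset preds B <= preds A},
      {subset fv B <= fv A} &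
      QK (Imp (Boxn n.+1 Bot) (Iff B (fill A B)))].

(* Main.v *)
Require Import Defs.
From mathcomp Require Import all_boot.
From Stdlib Require Import Relation_Operators.

Set Implicit Arguments.
Unset Strict Implicit.
Unset Printing Implicit Defensive.

(* The fixed point is B = A^(n+1)(Top).  If Box^k Bot proves B <-> C then it
   proves D(B) <-> D(C) for every D, since Box^k Bot passes under boxes; if D is
   modalized, every use of B <-> C happens under a box, so that Box^(k+1) Bot
   suffices.  Starting from the trivial case k = 0, induction shows that
   Box^k Bot proves A^k(Top) <-> A^(k+1)(Top).  The map A |-> A^(n+1)(Top) is
   computed by a lambda-term that recurses on the Scott encoding of A through
   self-application. *)

(** * Derivations in QK *)

Section Derivations.
Variable V : Type.
Implicit Types A B C D H X : form V.

Lemma QK_weaken H A : QK A -> QK (Imp H A).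
Proof. exact: QK_mp (QK_K _ _). Qed.

Lemma QK_mp_under H A B : QK (Imp H (Imp A B)) -> QK (Imp H A) -> QK (Imp H B).
Proof. by move=> /(QK_mp (QK_S _ _ _)); apply: QK_mp. Qed.

Lemma QK_trans A B C : QK (Imp A B) -> QK (Imp B C) -> QK (Imp A C).
Proof. by move=> AB BC; apply: QK_mp_under AB; apply: QK_weaken. Qed.

Lemma QK_refl A : QK (Imp A A).
Proof. by apply: (@QK_mp_under _ (Imp A A)); apply: QK_K. Qed.

Lemma QK_compl A B C : QK (Imp (Imp B C) (Imp (Imp A B) (Imp A C))).
Proof. exact: QK_trans (QK_K _ _) (QK_S _ _ _). Qed.

Lemma QK_compr A B C : QK (Imp (Imp A B) (Imp (Imp B C) (Imp A C))).
Proof.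
apply: QK_trans (QK_K (Imp A B) (Imp B C)) _.
by apply: QK_mp (QK_S _ _ _) _; apply: QK_compl.
Qed.

Lemma QK_trans_under H A B C :
  QK (Imp H (Imp A B)) -> QK (Imp H (Imp B C)) -> QK (Imp H (Imp A C)).
Proof.
by move=> AB; apply: QK_mp_under; apply: QK_trans AB (QK_compr _ _ _).
Qed.

(** Weakening $\neg\neg A$ to $\neg\neg\neg\neg A\to\neg\neg A$ and applying [QK_contra] twice gives
    $\neg\neg A\to A$, still under the hypothesis $\neg\neg A$; the two copies are then merged. *)
Lemma QK_dne A : QK (Imp (Neg (Neg A)) A).
Proof.
apply: QK_mp_under (QK_refl _).
apply: QK_trans (QK_K _ (Neg (Neg (Neg (Neg A))))) _.
exact: QK_trans (QK_contra _ _) (QK_contra _ _).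
Qed.

Lemma QK_dni A : QK (Imp A (Neg (Neg A))).
Proof. exact: QK_mp (QK_contra _ _) (QK_dne _). Qed.

Lemma QK_contrapos_under H A B :
  QK (Imp H (Imp A B)) -> QK (Imp H (Imp (Neg B) (Neg A))).
Proof.
move=> AB; apply: QK_trans (QK_contra _ _).
apply: QK_trans_under (QK_weaken _ (QK_dni _)).
exact: QK_trans_under (QK_weaken _ (QK_dne _)) AB.
Qed.

Lemma QK_and_intro_under H A B :
  QK (Imp H A) -> QK (Imp H B) -> QK (Imp H (And A B)).
Proof.
move=> hA hB.
apply: QK_mp_under (QK_trans hB (QK_dni _)).
apply: QK_contrapos_under.
have: QK (Imp A (Imp (Imp A (Neg B)) (Neg B))); last exact: QK_trans.
apply: QK_trans (QK_K A (Imp A (Neg B))) _.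
exact: QK_mp (QK_S _ _ _) (QK_refl _).
Qed.

Lemma QK_imp_under H A A' B B' :
  QK (Imp H (Imp A' A)) -> QK (Imp H (Imp B B')) ->
  QK (Imp H (Imp (Imp A B) (Imp A' B'))).
Proof.
move=> hA hB; apply: QK_trans_under (QK_trans hA (QK_compr _ _ _)) _.
exact: QK_trans hB (QK_compl _ _ _).
Qed.

Lemma vsubst_id u A : vsubst u u A = A.
Proof.
elim: A => //= [i us|A ->|A -> B ->|w A ->|A ->] //; last by rewrite if_same.
by congr Atom; rewrite -[RHS]map_id; apply: eq_map => x; case: eqP.
Qed.

Lemma free_for_refl u A : free_for u u A.
Proof.
elim: A => //= [A -> B ->|w A ->] //.
by rewrite mem_filter andbT; case: (eqVneq u w) => //= _; rewrite orbT.
Qed.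

Lemma QK_all_elim u A : QK (Imp (All u A) A).
Proof. by rewrite -{2}(vsubst_id u A); apply/QK_inst/free_for_refl. Qed.

(** After generalizing $H\to(\forall u A\to B)$, the quantifier moves past $H$ and then past
    $\forall u A$, neither of which has $u$ free. *)
Lemma QK_all_under u H A B : u \notin fv H ->
  QK (Imp H (Imp A B)) -> QK (Imp H (Imp (All u A) (All u B))).
Proof.
move=> uH AB.
have uA : u \notin fv (All u A) by rewrite /= mem_filter eqxx.
apply: QK_trans (QK_distr _ uA); apply: QK_mp (QK_distr _ uH) _.
by apply: QK_gen; apply: QK_trans_under AB; apply/QK_weaken/QK_all_elim.
Qed.

Lemma QK_box_mono A B : QK (Imp A B) -> QK (Imp (Box A) (Box B)).
Proof. by move=> /QK_nec; apply: QK_mp (QK_norm _ _). Qed.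

Lemma QK_box_under H A B :
  QK (Imp H (Imp A B)) -> QK (Imp (Box H) (Imp (Box A) (Box B))).
Proof. by move=> /QK_box_mono AB; apply: QK_trans AB (QK_norm _ _). Qed.

Lemma fv_Boxn_Bot k : fv (Boxn k (@Bot V)) = [::].
Proof. by elim: k. Qed.

(** Boxing $\bot\to\Box\bot$ $k$ times gives the instance of $H\to\Box H$ that lets the hypothesis
    pass under boxes. *)
Lemma QK_Boxn_BotS k : QK (Imp (Boxn k (@Bot V)) (Boxn k.+1 Bot)).
Proof. by elim: k => [|k /QK_box_mono //]; apply: QK_bot. Qed.

End Derivations.

(** * Fixed points modulo iterated boxes *)

(** Two separate implications avoid handling the encoded conjunction of [Iff], which is assembled
    only once, at the end. *)
Definition equiv_under V (H A B : form V) :=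
  QK (Imp H (Imp A B)) /\ QK (Imp H (Imp B A)).

Section EquivUnder.
Variable V : Type.
Implicit Types A B H : form V.

Lemma equiv_under_refl H A : equiv_under H A A.
Proof. by split; apply/QK_weaken/QK_refl. Qed.

Lemma equiv_under_neg H A B : equiv_under H A B -> equiv_under H (Neg A) (Neg B).
Proof. by case=> AB BA; split; apply: QK_contrapos_under. Qed.

Lemma equiv_under_imp H A A' B B' : equiv_under H A A' -> equiv_under H B B' ->
  equiv_under H (Imp A B) (Imp A' B').
Proof. by case=> ? ? [? ?]; split; apply: QK_imp_under. Qed.

Lemma equiv_under_all u H A B : u \notin fv H ->
  equiv_under H A B -> equiv_under H (All u A) (All u B).
Proof. by move=> uH [AB BA]; split; apply: QK_all_under. Qed.

Lemma equiv_under_box H A B :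
  equiv_under H A B -> equiv_under (Box H) (Box A) (Box B).
Proof. by case=> AB BA; split; apply: QK_box_under. Qed.

End EquivUnder.

(** Variable capture by the literal replacement is harmless: the equivalence is a theorem under a
    closed hypothesis, so it may be generalized over any variable. *)
Lemma equiv_under_fill k (D : L') (B C : L) :
  equiv_under (Boxn k Bot) B C ->
  equiv_under (Boxn k Bot) (fill D B) (fill D C).
Proof.
move=> BC; elim: D => [||[]|i us|D IH|D IH E IH'|u D IH|D IH] //=;
  try exact: equiv_under_refl.
- exact: equiv_under_neg.
- exact: equiv_under_imp.
- by apply: equiv_under_all; rewrite ?fv_Boxn_Bot.
(* The hypothesis has gained a box here; [QK_Boxn_BotS] removes it. *)
- have [DBC DCB] := equiv_under_box IH.
  by split; apply: QK_trans (QK_Boxn_BotS _ k) _.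
Qed.

Lemma equiv_under_fill_modalized k (D : L') (B C : L) :
  modalized D -> equiv_under (Boxn k Bot) B C ->
  equiv_under (Boxn k.+1 Bot) (fill D B) (fill D C).
Proof.
move=> mD BC; elim: D mD => [||q|i us|D IH|D IH E IH'|u D IH|D _] //=;
  try by move=> _; apply: equiv_under_refl.
- by move=> /IH; apply: equiv_under_neg.
- by case/andP=> /IH hD /IH'; apply: equiv_under_imp.
- by move=> /IH; apply: equiv_under_all; rewrite (fv_Boxn_Bot _ k.+1).
(* The formula inside the box need not be modalized, so the unrestricted lemma replaces the
   induction hypothesis, and the new box accounts for [k.+1]. *)
- by move=> _; apply/equiv_under_box/equiv_under_fill.
Qed.

Definition iter_fill (k : nat) (A : L') : L := iter k (fill A) Top.

Lemma equiv_under_iter_fill k (A : L') : modalized A ->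
  equiv_under (Boxn k Bot) (iter_fill k A) (fill A (iter_fill k A)).
Proof.
move=> mA; elim: k => [|k IH]; first by split; apply: QK_bot.
exact: equiv_under_fill_modalized.
Qed.

(** * Predicate symbols and free variables of the iterates *)

Lemma preds_fill (A : L') (B : L) :
  {subset preds (fill A B) <= preds A ++ preds B}.
Proof.
elim: A => //= [_|i us|A IHA A' IHA'] x //; first by rewrite !inE => ->.
rewrite !mem_cat; by case/orP=> [/IHA|/IHA']; rewrite mem_cat => /orP[] ->; rewrite ?orbT.
Qed.

Lemma fv_fill (A : L') (B : L) : {subset fv (fill A B) <= fv A ++ fv B}.
Proof.
elim: A => //= [_|i us|A IHA A' IHA'|u A IHA] x //; rewrite !mem_cat.
- by move=> ->.
- by case/orP=> [/IHA|/IHA']; rewrite mem_cat => /orP[] ->; rewrite ?orbT.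
- by rewrite !mem_filter => /andP[-> /IHA]; rewrite mem_cat.
Qed.

Lemma preds_iter_fill k (A : L') : {subset preds (iter_fill k A) <= preds A}.
Proof.
by elim: k => //= k IH x /preds_fill; rewrite mem_cat => /orP[//|/IH].
Qed.

Lemma fv_iter_fill k (A : L') : {subset fv (iter_fill k A) <= fv A}.
Proof.
by elim: k => //= k IH x /fv_fill; rewrite mem_cat => /orP[//|/IH].
Qed.

Lemma fixed_point_iter_fill n (A : L') :
  modalized A -> fixed_point_mod n A (iter_fill n.+1 A).
Proof.
move=> mA; split; [exact: preds_iter_fill | exact: fv_iter_fill |].
by have [AB BA] := equiv_under_iter_fill n.+1 mA; apply: QK_and_intro_under.
Qed.

(** * Computing with Scott encodings *)

Definition is_lam (s : term) : bool := if s is Lam _ then true else false.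

(** An abstraction can be the argument of [step_beta]; closedness keeps it unchanged by later
    substitutions. *)
Definition value (s : term) : bool := is_lam s && closed_at 0 s.

Lemma closed_atW k l s : k <= l -> closed_at k s -> closed_at l s.
Proof.
elim: s k l => /= [i|s IHs t IHt|s IHs] k l kl.
- by move=> /leq_trans; apply.
- by case/andP=> /(IHs _ _ kl) -> /(IHt _ _ kl).
- exact: IHs.
Qed.

Lemma tsubst_closed_at l s k t : l <= k -> closed_at l s -> tsubst s k t = s.
Proof.
elim: s l k => /= [i|s IHs s' IHs'|s IHs] l k lk.
- by move=> /leq_trans/(_ lk); case: eqP => // ->; rewrite ltnn.
- by case/andP=> /(IHs _ _ lk) -> /(IHs' _ _ lk) ->.
- by move=> /IHs ->.
Qed.

Lemma tsubst_closed s k t : closed_at 0 s -> tsubst s k t = s.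
Proof. exact: tsubst_closed_at. Qed.

Lemma reduces_refl s : reduces s s.
Proof. exact: rt_refl. Qed.

Lemma reduces_trans s t u : reduces s t -> reduces t u -> reduces s u.
Proof. exact: rt_trans. Qed.

Lemma reduces_app s s' t t' :
  reduces s s' -> reduces t t' -> reduces (App s t) (App s' t').
Proof.
move=> ss' tt'; apply: (@reduces_trans _ (App s' t)).
- elim: ss' => [x y xy|x|x y z _ xy _ yz]; last exact: reduces_trans yz.
  + exact/rt_step/step_appl.
  + exact: reduces_refl.
- elim: tt' => [x y xy|x|x y z _ xy _ yz]; last exact: reduces_trans yz.
  + exact/rt_step/step_appr.
  + exact: reduces_refl.
Qed.

Lemma reduces_foldl_App s s' ts :
  reduces s s' -> reduces (foldl App s ts) (foldl App s' ts).
Proof.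
elim: ts s s' => //= t ts IH s s' ss'.
by apply: IH; apply: reduces_app (reduces_refl _).
Qed.

(* The first element of [hs] goes to the outermost abstraction, hence to the
   largest index. *)
Fixpoint msubst (s : term) (hs : seq term) : term :=
  if hs is h :: hs' then msubst (tsubst s (size hs') h) hs' else s.

Lemma tsubst_iter_Lam c s k t :
  tsubst (iter c Lam s) k t = iter c Lam (tsubst s (c + k) t).
Proof. by elim: c k => //= c IH k; rewrite IH addnS. Qed.

(** Contracting the outermost redex substitutes beneath the [size hs'] remaining abstractions, hence
    at index [size hs'], exactly as [msubst] does. *)
Lemma reduces_betas s hs : all value hs ->
  reduces (foldl App (iter (size hs) Lam s) hs) (msubst s hs).
Proof.
elim: hs s => [|h hs IH] s /=; first by move=> _; apply: reduces_refl.
case/andP=> /andP[lamh _] /IH r; apply: reduces_trans (r _).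
apply: reduces_foldl_App.
rewrite -[X in tsubst _ X _]addn0 -tsubst_iter_Lam.
by case: h lamh => // h _; apply/rt_step/step_beta.
Qed.

Lemma msubst_closed s hs : closed_at 0 s -> msubst s hs = s.
Proof. by move=> cs; elim: hs => //= h hs; rewrite tsubst_closed. Qed.

Lemma msubst_foldl_App s ts hs : all (closed_at 0) ts ->
  msubst (foldl App s ts) hs = foldl App (msubst s hs) ts.
Proof.
move=> cts; elim: hs s => //= h hs IH s; rewrite -IH; congr msubst.
elim: ts s cts {IH} => //= t ts IHt s /andP[ct cts].
by rewrite IHt //= (tsubst_closed _ _ ct).
Qed.

Lemma msubst_Var hs j : all value hs -> j < size hs ->
  msubst (Var (size hs - j.+1)) hs = nth (Var 0) hs j.
Proof.
elim: hs j => //= h hs IH [|j] /andP[/andP[_ ch] vhs] jhs.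
  by rewrite subn1 eqxx msubst_closed.
rewrite subSS /= -(IH _ vhs jhs); case: eqP => // e.
by move: (ltn_subrL j.+1 (size hs)); rewrite e ltnn (leq_trans _ (jhs : j < size hs)).
Qed.

(** Scott-encoded data act as their own case distinction: given one branch per constructor, they
    select the branch of theirs and pass it the constructor's arguments. *)
Lemma scott_case c j ts hs : size hs = c -> j < c ->
  all value hs -> all (closed_at 0) ts ->
  reduces (foldl App (scott c j ts) hs) (foldl App (nth (Var 0) hs j) ts).
Proof.
move=> <- jhs vhs cts; rewrite -(msubst_Var vhs jhs) -msubst_foldl_App //.
exact: reduces_betas.
Qed.

Lemma closed_at_iter_Lam c k s : closed_at k (iter c Lam s) = closed_at (c + k) s.
Proof. by elim: c k => //= c IH k; rewrite IH addnS. Qed.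

Lemma closed_at_foldl_App k s ts :
  closed_at k (foldl App s ts) = closed_at k s && all (closed_at k) ts.
Proof. by elim: ts s => /= [|t ts IH] s; rewrite ?andbT // IH /= andbA. Qed.

Lemma value_scott c j ts : j < c -> all (closed_at 0) ts -> value (scott c j ts).
Proof.
move=> jc cts; rewrite /value closed_at_iter_Lam closed_at_foldl_App /=.
rewrite addn0 ltn_subrL /= (leq_ltn_trans _ jc) //; apply/andP; split.
  by case: c jc.
by apply: sub_all cts => t; apply: closed_atW.
Qed.

Lemma value_closed s : value s -> closed_at 0 s.
Proof. by case/andP. Qed.

Lemma value_enc_nat i : value (enc_nat i).
Proof.
by elim: i => //= i /value_closed ci; apply: value_scott; rewrite //= ci.
Qed.

Lemma value_enc_seq us : value (enc_seq us).
Proof.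
elim: us => //= u us /value_closed cus; apply: value_scott; rewrite //= cus.
by rewrite value_closed ?value_enc_nat.
Qed.

Lemma value_enc V (A : form V) : value (enc A).
Proof.
elim: A => [||q|i us|A IH|A IH B IH'|u A IH|A IH] //=; apply: value_scott;
  by rewrite //= ?(value_closed (value_enc_nat _)) ?(value_closed (value_enc_seq _))
     ?value_closed.
Qed.

(** * A lambda-term for substitution into formulas *)

(* The [j]-th constructor of formulas, of arity [k], as a function. *)
Definition con (j k : nat) : term :=
  iter k Lam (scott 8 j (rev [seq Var i | i <- iota 8 k])).

Definition self_app (g c b : term) : term := App (App (App g g) c) b.

(* What to do for each constructor of A, where [g m] and [b m] denote, under m
   additional binders, the function itself (called recursively by
   self-application) and the encoding of B. *)
Definition fill_cases (g b : nat -> term) : seq term :=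
  [:: enc (@Top void); enc (@Bot void); b 0; con 3 2;
      Lam (App (con 4 1) (self_app (g 1) (Var 0) (b 1)));
      Lam (Lam (App (App (con 5 2) (self_app (g 2) (Var 1) (b 2)))
                    (self_app (g 2) (Var 0) (b 2))));
      Lam (Lam (App (App (con 6 2) (Var 1)) (self_app (g 2) (Var 0) (b 2))));
      Lam (App (con 7 1) (self_app (g 1) (Var 0) (b 1)))].

(** Under the three binders of [fill_rec], index 2 is the function itself, 1 the encoding of $A$,
    serving as case distinction, and 0 the encoding of $B$; crossing $m$ binders adds $m$. *)
Definition fill_body : term :=
  foldl App (Var 1) (fill_cases (fun m => Var (2 + m)) Var).

Definition fill_rec : term := iter 3 Lam fill_body.

(** The head variable of a Scott encoding is bound by its own eight abstractions, so substituting
    constructor arguments at indices 8 and 9 does not touch it. *)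
Lemma sub8S_neq j k : 8 <= k -> (8 - j.+1 == k) = false.
Proof. by move=> k8; rewrite ltn_eqF // (leq_trans _ k8) // ltn_subrL. Qed.

Lemma reduces_con1 j s : value s ->
  reduces (App (con j 1) s) (scott 8 j [:: s]).
Proof.
move=> vs; have := @reduces_betas (scott 8 j [:: Var 8]) [:: s].
by rewrite /= vs sub8S_neq // => /(_ isT).
Qed.

Lemma reduces_con2 j s t : value s -> value t ->
  reduces (App (App (con j 2) s) t) (scott 8 j [:: s; t]).
Proof.
move=> vs vt; have := @reduces_betas (scott 8 j [:: Var 9; Var 8]) [:: s; t].
rewrite /= vs vt !sub8S_neq //= (tsubst_closed _ _ (value_closed vs)) => r.
by rewrite /= sub8S_neq // in r; apply: r.
Qed.

(** The branch for [Neg] and [Box], with [f] the constructor and [r] the result of the recursive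
    call on the immediate subformula. *)
Lemma reduces_map1 f g b c r :
  closed_at 0 f -> closed_at 0 g -> closed_at 0 b -> value c ->
  reduces (self_app g c b) r ->
  reduces (App (Lam (App f (self_app g (Var 0) b))) c) (App f r).
Proof.
move=> cf cg cb vc gr.
apply: reduces_trans (@reduces_betas _ [:: c] _) _; first by rewrite /all vc.
rewrite /= !tsubst_closed ?(value_closed vc) //.
exact: reduces_app (reduces_refl _) gr.
Qed.

Lemma reduces_map2 f g b c d r r' :
  closed_at 0 f -> closed_at 0 g -> closed_at 0 b -> value c -> value d ->
  reduces (self_app g c b) r -> reduces (self_app g d b) r' ->
  reduces (App (App (Lam (Lam (App (App f (self_app g (Var 1) b))
                                   (self_app g (Var 0) b)))) c) d)
          (App (App f r) r').
Proof.
move=> cf cg cb vc vd gr gr'.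
apply: reduces_trans (@reduces_betas _ [:: c; d] _) _; first by rewrite /all vc vd.
rewrite /= !tsubst_closed ?(value_closed vc) ?(value_closed vd) //.
exact: reduces_app (reduces_app (reduces_refl _) gr) gr'.
Qed.

(** The branch for [All]: the bound variable [c] is copied and only the formula [d] is processed
    recursively. *)
Lemma reduces_map_snd f g b c d r :
  closed_at 0 f -> closed_at 0 g -> closed_at 0 b -> value c -> value d ->
  reduces (self_app g d b) r ->
  reduces (App (App (Lam (Lam (App (App f (Var 1))
                                   (self_app g (Var 0) b)))) c) d)
          (App (App f c) r).
Proof.
move=> cf cg cb vc vd gr.
apply: reduces_trans (@reduces_betas _ [:: c; d] _) _; first by rewrite /all vc vd.
rewrite /= !tsubst_closed ?(value_closed vc) ?(value_closed vd) //.
exact: reduces_app (reduces_refl _) gr.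
Qed.

Lemma value_fill_cases g b : value g -> value b ->
  all value (fill_cases (fun=> g) (fun=> b)).
Proof.
move=> /value_closed cg vb.
have cgk k : closed_at k g by apply: closed_atW cg.
have cbk k : closed_at k b by apply: closed_atW (value_closed vb).
by rewrite /= vb /value /= !cgk !cbk.
Qed.

(** The families become constant because closed terms need no shifting under binders. *)
Lemma msubst_fill_body g a b : closed_at 0 g -> closed_at 0 a ->
  msubst fill_body [:: g; a; b] = foldl App a (fill_cases (fun=> g) (fun=> b)).
Proof.
move=> cg ca.
have tg := fun k t => tsubst_closed k t cg.
have ta := fun k t => tsubst_closed k t ca.
by rewrite /= !(tg, ta).
Qed.

Lemma reduces_fill_rec (A : L') (B : L) :
  reduces (self_app fill_rec (enc A) (enc B)) (enc (fill A B)).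
Proof.
have vf : value fill_rec by [].
have cf := value_closed vf.
have unfold_rec (C : L') : reduces (self_app fill_rec (enc C) (enc B))
    (foldl App (enc C) (fill_cases (fun=> fill_rec) (fun=> enc B))).
  rewrite -msubst_fill_body ?value_closed ?value_enc //.
  apply: (@reduces_betas fill_body [:: _; _; _]).
  by rewrite /all vf !value_enc.
elim: A => [||q|i us|A IH|A IHA C IHC|u A IH|A IH];
  apply: reduces_trans (unfold_rec _) _;
  (* The encoding of the formula now selects its branch. *)
  (apply: reduces_trans; first (apply: scott_case;
     rewrite ?value_fill_cases ?value_enc //=
        ?(value_closed (value_enc_nat _)) ?(value_closed (value_enc_seq _))
        ?value_closed ?value_enc //)).
1-3: exact: reduces_refl.
- by apply: reduces_con2; rewrite ?value_enc_nat ?value_enc_seq.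
(* The constructor is contracted last, once the recursive call has returned an encoding, which is a
   value. *)
- apply: reduces_trans (reduces_con1 4 (value_enc _)).
  by apply: reduces_map1; rewrite ?value_closed ?value_enc.
- apply: reduces_trans (reduces_con2 5 (value_enc _) (value_enc _)).
  by apply: reduces_map2; rewrite ?value_closed ?value_enc.
- apply: reduces_trans (reduces_con2 6 (value_enc_nat _) (value_enc _)).
  by apply: reduces_map_snd; rewrite ?value_closed ?value_enc ?value_enc_nat.
- apply: reduces_trans (reduces_con1 7 (value_enc _)).
  by apply: reduces_map1; rewrite ?value_closed ?value_enc.
Qed.

(** As $k$ is fixed, the iteration is unrolled into $k$ nested calls of [fill_rec], evaluated from
    the innermost outwards. *)
Lemma calculable_iter_fill k : effectively_calculable (iter_fill k).
Proof.
pose body k := iter k (self_app fill_rec (Var 0)) (enc (@Top void)).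
have cbody i : closed_at 1 (body i) by elim: i.
exists (Lam (body k)) => [|A]; first exact: cbody.
apply: reduces_trans (@reduces_betas _ [:: enc A] _) _.
  by rewrite /all value_enc.
rewrite [msubst _ _]/=; elim: {cbody} k => [|k IH]; first exact: reduces_refl.
apply: reduces_trans (reduces_fill_rec _ _).
exact: reduces_app (reduces_refl _) IH.
Qed.

Theorem theorem4p1 (n : nat) :
  (forall A : L', modalized A -> exists B : L, fixed_point_mod n A B) /\
  (exists F : L' -> L, effectively_calculable F /\
     forall A : L', modalized A -> fixed_point_mod n A (F A)).
Proof.
have fp := @fixed_point_iter_fill n.
split=> [A /fp|]; first by exists (iter_fill n.+1 A).
by exists (iter_fill n.+1); split; first exact: calculable_iter_fill.
Qed.
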